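(* Let $1<p<\infty$ and let $\{\lambda_n\}_{n=1}^\infty\in\mathrm{GBV}$ satisfy $$\sum_{n=1}^\infty n^{p-2}\lambda_n^p<\infty .$$ Let $f(x)=\sum_{n=1}^\infty\lambda_n\cos nx$. Then there is a constant $C>0$ (depending on $\{\lambda_n\}$ and $p$ but not on $n$) such that for every $n\ge1$, $$\omega(f,n^{-1})_{L^p}\le C n^{-1}\Big(\sum_{k=1}^{n-1}k^{2p-2}\lambda_k^p\Big)^{1/p}+C\Big(\sum_{k=n}^\infty k^{p-2}\lambda_k^p\Big)^{1/p}.$$
   Context: $\Delta c_n:=c_n-c_{n+1}$. A sequence $\mathbf c=\{c_n\}_{n=1}^\infty$ belongs to the class $\mathrm{GBV}$ if $c_n\ge 0$ for all $n$, $c_n\to 0$ as $n\to\infty$, and there is a positive constant $M(\mathbf c)$ depending only on $\mathbf c$ such that $\sum_{n=m}^{2m}|\Delta c_n|\le M(\mathbf c)\,c_m$ for all $m=1,2,\dots$. $L^p$ denotes the space of $2\pi$-periodic functions whose $p$-th power is integrable over a period, and $\omega(f,t)_{L^p}=\sup_{0<h\le t}\|f(\cdot+h)-f(\cdot)\|_{L^p[0,2\pi]}$ is the $L^p$ modulus of continuity. An empty sum (the case $n=1$) is $0$. *)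

(* Defs.v *)
From mathcomp Require Import all_boot all_order all_algebra.
From mathcomp Require Import all_classical all_reals all_analysis.
Set Implicit Arguments. Unset Strict Implicit. Unset Printing Implicit Defensive.
Import Order.TTheory GRing.Theory Num.Theory.
Import numFieldNormedType.Exports.
Local Open Scope classical_set_scope.
Local Open Scope ring_scope.

(* Sequences are indexed from 1; the value at index 0 is ignored. *)
Definition Delta {R : realType} (c : nat -> R) (n : nat) : R := c n - c n.+1.

Definition GBV {R : realType} (c : nat -> R) : Prop :=
  (forall n, (1 <= n)%N -> 0 <= c n) /\
  (c @ \oo --> (0 : R)) /\
  exists M : R, 0 < M /\
    forall m, (1 <= m)%N -> \sum_(m <= n < (2 * m).+1) `|Delta c n| <= M * c m.

(* f(x) = sum_{n>=1} lam_n cos(n x), as the limit of the partial sums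
   (pointwise, where it converges). *)
Definition cos_series {R : realType} (lam : nat -> R) (x : R) : R :=
  \big[+%R/0%R]_(1 <= n <oo) (lam n * cos (n%:R * x)).

Definition Lp_diff {R : realType} (p : R) (g : R -> R) (h : R) : \bar R :=
  poweR (\int[@lebesgue_measure R]_(x in `[0%R, (2 * pi)%R]) ((`|g (x + h) - g x| `^ p)%:E))%E
        p^-1.

Definition modcont {R : realType} (p : R) (g : R -> R) (t : R) : \bar R :=
  ereal_sup [set Lp_diff p g h | h in `]0%R, t]].

(* Main.v *)
Require Import Defs.
From mathcomp Require Import all_boot all_order all_algebra.
From mathcomp Require Import all_classical all_reals all_analysis.
From mathcomp Require Import ring lra measurable_realfun.
Import Order.TTheory GRing.Theory Num.Theory.
Import numFieldNormedType.Exports.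
Local Open Scope classical_set_scope.
Local Open Scope ring_scope.

(* Put h = 1/n and let D_k be the Dirichlet sum cos t + ... + cos kt. For
   0 < u <= v <= pi with v - u <= h one has
     |D_k(v) - D_k(u)| <= 16 min(k, 1/u) min(1, kh),
   so summation by parts together with the GBV condition on dyadic blocks gives,
   when 1/u <= 2^i,
     |f(v) - f(u)| <= 64 M sum_j lam_(2^j) min(1, 2^j h) min(2^j, 2^i).
   With g_j = 2^(j(1 - 1/p)) lam_(2^j) min(1, 2^j h) the right-hand side is
   2^(i/p) times the convolution of g with a kernel bounded by rho^|i - j|,
   rho < 1. By Jensen's inequality its p-th power is at most a constant times
   2^i E_i, where E_i = sum_j rho^|i - j| g_j^p. The evenness and periodicity of f
   reduce the increment f(x + t) - f(x), 0 < t <= h, to such u and v, where u is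
   the distance from x to one of 0, 2 pi, 2 pi - t; as the points with u ~ 2^(-i)
   have measure of order 2^(-i), the L^p integral of the increment is at most a
   constant times sum_i E_i, hence times sum_j g_j^p. By quasi-monotonicity of lam
   on dyadic blocks, the latter is bounded by
   sum_k k^(p - 2) lam_k^p min(1, k/n)^p, which is the p-th power form of the
   right-hand side of the theorem. *)

(** * Dirichlet sums *)

Lemma ler_norm_sinB {R : realType} (x y : R) : `|sin x - sin y| <= `|x - y|.
Proof.
wlog yx : x y / y <= x.
  move=> H; have [/H//|/ltW/H] := leP y x.
  by rewrite distrC (distrC y).
have [|c _ ->] := @MVT_segment R sin cos y x yx (fun x _ => is_derive_sin x).
  exact/continuous_subspaceT/continuous_sin.
by rewrite normrM ler_piMl// ler_norml cos_geN1 cos_le1.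
Qed.

Lemma ler_norm_cosB {R : realType} (x y : R) : `|cos x - cos y| <= `|x - y|.
Proof.
rewrite -!sinDpihalf; apply: le_trans (ler_norm_sinB _ _) _.
by rewrite opprD addrACA subrr addr0.
Qed.

Lemma cos_ge_half {R : realType} (x : R) : 0 <= x <= 1 -> 2^-1 <= cos x.
Proof.
move=> /andP[x0 x1].
have -> : cos x = 1 - 2 * sin (x / 2) ^+ 2.
  by rewrite [in LHS](splitr x) cosD -!expr2
    cos2sin2; ring.
have := ler_norm_sinB (x / 2) 0.
rewrite sin0 !subr0 (@ger0_norm _ (x / 2)) ?divr_ge0// => h.
have : `|sin (x / 2)| ^+ 2 <= (1 / 2) ^+ 2.
  by rewrite ler_sqr ?nnegrE ?(le_trans h)//; lra.
rewrite real_normK ?num_real//; lra.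
Qed.

(** The mean value theorem gives sin(x/2) >= x/4 because the cosine stays above 1/2 there, and the
    double-angle formula carries this to x. The range up to 2 suffices for [sin_half_ge], since pi/2
    < 2. *)
Lemma sin_ge_quarter {R : realType} (x : R) : 0 <= x <= 2 -> x / 4 <= sin x.
Proof.
move=> /andP[x0 x2].
have -> : sin x = 2 * (sin (x / 2) * cos (x / 2)).
  by rewrite [in LHS](splitr x) sinD; ring.
have c1 : 2^-1 <= cos (x / 2) by apply: cos_ge_half; lra.
have [|c|c] := @MVT_segment R sin cos 0 (x / 2) _ (fun x _ => is_derive_sin x).
- lra.
- exact/continuous_subspaceT/continuous_sin.
rewrite in_itv/= sin0 !subr0 => /andP[c0 cx] ->.
have : 2^-1 <= cos c by apply: cos_ge_half; lra.
move=> c2.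
have : 2^-1 * (x / 2) <= cos c * (x / 2) by apply: ler_wpM2r => //; lra.
move=> s1; have : 2^-1 * (x / 2) * 2^-1 <= cos c * (x / 2) * cos (x / 2).
  by apply: ler_pM => //; lra.
lra.
Qed.

Definition cos_sum {R : realType} (k : nat) (t : R) : R :=
  \sum_(1 <= j < k.+1) cos (j%:R * t).

(** The products 2 sin(t/2) cos(jt) = sin((j + 1/2)t) - sin((j - 1/2)t) telescope. Leaving the
    identity undivided avoids a condition on t. *)
Lemma cos_sumE {R : realType} (k : nat) (t : R) :
  2 * sin (t / 2) * cos_sum k t = sin ((k%:R + 2^-1) * t) - sin (t / 2).
Proof.
rewrite /cos_sum; elim: k => [|k IH].
  by rewrite big_geq// mulr0 add0r mulrC subrr.
rewrite big_nat_recr//= mulrDr IH.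
have -> : (k.+1%:R + 2^-1) * t = k.+1%:R * t + t / 2 by ring.
have -> : (k%:R + 2^-1) * t = k.+1%:R * t - t / 2.
  by rewrite -natr1; field.
rewrite sinB sinD; ring.
Qed.

Lemma cos_sum_le_nat {R : realType} (k : nat) (t : R) :
  `|cos_sum k t| <= k%:R.
Proof.
apply: le_trans (ler_norm_sum _ _ _) _.
have -> : k%:R = \sum_(1 <= j < k.+1) (1 : R).
  by rewrite sumr_const_nat subn1.
by apply: ler_sum => j _; rewrite ler_norml cos_geN1 cos_le1.
Qed.

Lemma sin_half_ge {R : realType} (t : R) : 0 <= t <= pi -> t / 8 <= sin (t / 2).
Proof.
move=> /andP[t0 tpi]; have := pihalf_lt2 R => p2.
have : t / 2 / 4 <= sin (t / 2) by apply: sin_ge_quarter; lra.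
lra.
Qed.

Lemma cos_sum_le_inv {R : realType} (k : nat) (t : R) : 0 < t <= pi ->
  `|cos_sum k t| <= 8 / t.
Proof.
move=> /andP[t0 tpi]; have := sin_half_ge t; rewrite tpi (ltW t0) => /(_ isT) s.
have : `|2 * sin (t / 2) * cos_sum k t| <= 2.
  rewrite cos_sumE; apply: le_trans (ler_normB _ _) _.
  by rewrite -[leRHS]/(1 + 1) lerD// ler_norml sin_geN1 sin_le1.
rewrite normrM ger0_norm; last by lra.
move=> h; rewrite ler_pdivlMr//.
have : `|cos_sum k t| * (t / 8) <= `|cos_sum k t| * sin (t / 2).
  by apply: ler_wpM2l.
lra.
Qed.

Lemma cos_sumB_le {R : realType} (k : nat) (u v h : R) :
  0 < u -> u <= v -> v <= pi -> v - u <= h ->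
  `|cos_sum k v - cos_sum k u| <=
    16 * Num.min (k%:R) u^-1 * Num.min 1 (k%:R * h).
Proof.
move=> u0 uv vpi vuh.
have v0 : 0 < v by exact: lt_le_trans uv.
have h0 : 0 <= h by rewrite (le_trans _ vuh)// subr_ge0.
have [->|k0] := posnP k.
  by rewrite /cos_sum !big_geq// subrr normr0 mulr_ge0// ?mulr_ge0// le_min
    ?mul0r ?ler01 ?lexx// invr_ge0 ltW.
have k1 : 1 <= k%:R :> R by rewrite ler1n.
have du : cos_sum k v - cos_sum k u = \sum_(1 <= j < k.+1)
    (cos (j%:R * v) - cos (j%:R * u)) by rewrite sumrB.
have b1 : `|cos_sum k v - cos_sum k u| <= k%:R * (k%:R * h).
  rewrite du; apply: le_trans (ler_norm_sum _ _ _) _.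
  have -> : k%:R * (k%:R * h) = \sum_(1 <= j < k.+1) (k%:R * h).
    by rewrite sumr_const_nat subn1 mulr_natl.
  apply: ler_sum_nat => j /andP[_ jk]; apply: le_trans (ler_norm_cosB _ _) _.
  by rewrite -mulrBr normrM ger0_norm// ger0_norm ?subr_ge0// ler_pM ?ler_nat// subr_ge0.
have b0 : `|cos_sum k v - cos_sum k u| <= 2 * k%:R.
  apply: le_trans (ler_normB _ _) _.
  by rewrite mulr_natl mulr2n lerD// cos_sum_le_nat.
have bu : `|cos_sum k u| <= 8 / u by apply: cos_sum_le_inv; rewrite u0 (le_trans uv).
have bv : `|cos_sum k v| <= 8 / u.
  apply: le_trans (_ : 8 / v <= _); first by apply: cos_sum_le_inv; rewrite v0.
  by rewrite ler_pM2l// lef_pV2 ?posrE.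
have b2 : `|cos_sum k v - cos_sum k u| <= 16 / u.
  by apply: le_trans (ler_normB _ _) _; lra.
(* Subtracting the closed forms at [u] and [v] gives the Lipschitz bound
   without differentiating the Dirichlet kernel. *)
have b3 : `|cos_sum k v - cos_sum k u| <= 12 / u * (k%:R * h).
  have sv : u / 8 <= sin (v / 2).
    apply: le_trans (sin_half_ge v _); last by rewrite ltW.
    by rewrite ler_pM2r.
  have e : 2 * sin (v / 2) * (cos_sum k v - cos_sum k u) =
     (sin ((k%:R + 2^-1) * v) - sin ((k%:R + 2^-1) * u)) -
     (sin (v / 2) - sin (u / 2)) - 2 * (sin (v / 2) - sin (u / 2)) * cos_sum k u.
    by have := cos_sumE k v; have := cos_sumE k u; lra.
  have s1 : `|sin (v / 2) - sin (u / 2)| <= h / 2.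
    apply: le_trans (ler_norm_sinB _ _) _.
    by rewrite -mulrBl ger0_norm ?mulr_ge0 ?subr_ge0//; lra.
  have s2 : `|sin ((k%:R + 2^-1) * v) - sin ((k%:R + 2^-1) * u)| <= (k%:R + 2^-1) * h.
    apply: le_trans (ler_norm_sinB _ _) _.
    rewrite -mulrBr normrM ger0_norm ?addr_ge0// ler_wpM2l ?addr_ge0//.
    by rewrite ger0_norm ?subr_ge0.
  have s3 : `|2 * (sin (v / 2) - sin (u / 2)) * cos_sum k u| <= h * k%:R.
    rewrite normrM ler_pM//; last exact: cos_sum_le_nat.
    by rewrite normrM ger0_norm//; lra.
  have : `|2 * sin (v / 2) * (cos_sum k v - cos_sum k u)| <= 3 * (k%:R * h).
    rewrite e; apply: le_trans (ler_normB _ _) _.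
    have := ler_normB (sin ((k%:R + 2^-1) * v) - sin ((k%:R + 2^-1) * u))
      (sin (v / 2) - sin (u / 2)) => s4.
    have : h <= k%:R * h by rewrite ler_peMl.
    lra.
  rewrite normrM ger0_norm; last by lra.
  move=> h1; rewrite mulrAC ler_pdivlMr//.
  have : `|cos_sum k v - cos_sum k u| * (u / 8) <=
    `|cos_sum k v - cos_sum k u| * sin (v / 2) by apply: ler_wpM2l.
  lra.
have kh : 0 <= k%:R * h by rewrite mulr_ge0.
have u1 : 0 < u^-1 by rewrite invr_gt0.
(* The four cases use [b0], [b1], [b2] and [b3], in this order. *)
rewrite /Num.min; case: ifP => _; case: ifP => _.
- lra.
- have : 0 <= k%:R * (k%:R * h) by rewrite mulr_ge0.
  by move=> kkh; rewrite -mulrA; lra.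
- lra.
- apply: le_trans b3 _; apply: ler_wpM2r => //; lra.
Qed.

Lemma sum_by_parts {R : realType} (lam : nat -> R) (t : R) (N : nat) :
  \sum_(1 <= k < N.+1) lam k * cos (k%:R * t) =
  \sum_(1 <= k < N.+1) Delta lam k * cos_sum k t + lam N.+1 * cos_sum N t.
Proof.
elim: N => [|N IH]; first by rewrite /cos_sum !big_geq// mulr0 addr0.
rewrite big_nat_recr//= IH [in RHS]big_nat_recr//= /Delta.
have -> : cos_sum N.+1 t = cos_sum N t + cos (N.+1%:R * t).
  by rewrite /cos_sum big_nat_recr.
ring.
Qed.

(** * Dyadic blocks of GBV sequences *)

Lemma ler_sum_nat_widen {R : numDomainType} (F : nat -> R) (m a b : nat) :
  (m <= a)%N -> (a <= b)%N -> (forall k, 0 <= F k) ->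
  \sum_(m <= k < a) F k <= \sum_(m <= k < b) F k.
Proof.
by move=> ma ab F0; rewrite [leRHS](big_cat_nat ma ab) lerDl sumr_ge0.
Qed.

Lemma big_nat_dyadic {R : realType} (F : nat -> R) (J : nat) :
  \sum_(1 <= k < 2 ^ J) F k =
  \sum_(0 <= j < J) \sum_(2 ^ j <= k < 2 ^ j.+1) F k.
Proof.
elim: J => [|J IH]; first by rewrite !big_geq.
rewrite [RHS]big_nat_recr//= -IH -big_cat_nat//= ?expn_gt0//.
by rewrite leq_exp2l.
Qed.

Section general_bounded_variation.
Context {R : realType} (lam : nat -> R) (M : R).
Hypothesis lam_ge0 : forall n, (1 <= n)%N -> 0 <= lam n.
Hypothesis M_gt0 : 0 < M.
Hypothesis lam_gbv : forall m, (1 <= m)%N ->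
  \sum_(m <= n < (2 * m).+1) `|Delta lam n| <= M * lam m.

(** Going from m to l subtracts increments whose indices lie in m, ..., 2m, the window of the GBV
    condition. This stands in for monotonicity. *)
Lemma gbv_quasi_decr (m l : nat) : (1 <= m)%N -> (m <= l <= (2 * m).+1)%N ->
  lam l <= (1 + M) * lam m.
Proof.
move=> m1 /andP[ml lm].
have -> : lam l = lam m - \sum_(m <= k < l) Delta lam k.
  have := telescope_sumr (fun k => - lam k) ml.
  under eq_bigr do rewrite opprK addrC.
  by rewrite /Delta => ->; ring.
rewrite mulrDl mul1r lerD2l; apply: le_trans (ler_norm _) _.
rewrite normrN; apply: le_trans (ler_norm_sum _ _ _) _.
apply: le_trans (lam_gbv m m1).
exact: ler_sum_nat_widen.
Qed.

(** The block 2^j <= k < 2^(j+1) lies in the GBV window of m = 2^j, so the weight leaves the block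
    sum as its bound [W j]. *)
Lemma gbv_dyadic_sum (w W : nat -> R) (J : nat) :
  (forall j k, (2 ^ j <= k < 2 ^ j.+1)%N -> w k <= W j) ->
  (forall j, 0 <= W j) ->
  \sum_(1 <= k < 2 ^ J) `|Delta lam k| * w k <=
  M * \sum_(0 <= j < J) lam (2 ^ j)%N * W j.
Proof.
move=> wW W0; rewrite big_nat_dyadic mulr_sumr; apply: ler_sum => j _.
apply: le_trans (_ : \sum_(2 ^ j <= k < 2 ^ j.+1) `|Delta lam k| * W j <= _).
  by apply: ler_sum_nat => k kj; rewrite ler_wpM2l// wW.
rewrite -mulr_suml mulrA; apply: ler_wpM2r => //.
apply: le_trans (lam_gbv (2 ^ j)%N _); last by rewrite expn_gt0.
rewrite expnS [leRHS](@big_cat_nat _ _ _ (2 * 2 ^ j)%N)//=.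
  by rewrite lerDl sumr_ge0.
by rewrite leq_pmull.
Qed.

Hypothesis lam_cvg0 : lam @ \oo --> (0 : R).

(** After summation by parts, |D_k(t)| <= 8/t makes the series absolutely convergent, and the
    boundary term tends to 0 with [lam]. *)
Lemma cos_series_cvg (B t : R) : 0 < t <= pi ->
  (forall J, \sum_(1 <= k < 2 ^ J) `|Delta lam k| <= B) ->
  cvgn (fun N => \sum_(1 <= k < N) lam k * cos (k%:R * t)).
Proof.
move=> tpi hB; have /andP[t0 _] := tpi.
suff : cvgn (fun N => \sum_(1 <= k < N.+1) lam k * cos (k%:R * t)).
  by move=> /cvg_ex[l hl]; apply/cvg_ex; exists l; rewrite -cvg_shiftS.
under eq_fun do rewrite sum_by_parts.
apply: is_cvgD.
  under eq_fun do rewrite big_add1/=.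
  apply: (@normed_cvg R R^o (fun k => Delta lam k.+1 * cos_sum k.+1 t)).
  apply: nondecreasing_is_cvgn.
    by apply/nondecreasing_seqP => n; rewrite /normed_series_of /series/= big_nat_recr//= lerDl.
  exists (B * (8 / t)) => _ [N _ <-]; rewrite /normed_series_of /series/=.
  apply: le_trans (_ : (\sum_(0 <= k < N) `|Delta lam k.+1|) * (8 / t) <= _).
    rewrite mulr_suml; apply: ler_sum => k _.
    by rewrite normrM ler_wpM2l// cos_sum_le_inv.
  apply: ler_wpM2r; first by rewrite divr_ge0// ltW.
  apply: le_trans (hB N).
  (* Reindexed from 1, the sum stops at N, and N < 2^N places it inside the bounded one. *)
  rewrite -[N in leLHS]/(N.+1.-1).
  rewrite -(big_add1 _ _ 0 N.+1 xpredT (fun k => `|Delta lam k|)).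
  by apply: ler_sum_nat_widen => //; exact: ltn_expl.
apply/cvg_ex; exists 0.
apply: (@squeeze_cvgr _ _ _ _ (fun N => - (lam N.+1 * (8 / t))) (fun N => lam N.+1 * (8 / t))).
- near=> N; rewrite -ler_norml normrM ger0_norm ?lam_ge0//.
  by rewrite ler_wpM2l ?lam_ge0// cos_sum_le_inv.
- rewrite -oppr0; apply: cvgN; rewrite -(mul0r (8 / t)).
  by apply: cvgMl; rewrite cvg_shiftS.
- rewrite -(mul0r (8 / t)).
  by apply: cvgMl; rewrite cvg_shiftS.
Unshelve. all: by end_near. Qed.

Lemma cos_seriesB_le (u v h B : R) (i : nat) :
  0 < u -> u <= v -> v <= pi -> v - u <= h -> 0 < h -> u^-1 <= 2 ^+ i ->
  (forall J, \sum_(0 <= j < J) lam (2 ^ j)%N *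
     (Num.min 1 (2 ^+ j * h) * Num.min (2 ^+ j) (2 ^+ i)) <= B) ->
  `|cos_series lam v - cos_series lam u| <= 64 * M * B.
Proof.
move=> u0 uv vpi vuh h0 ui hB.
have v0 : 0 < v by exact: lt_le_trans uv.
have two_ge1 k : 1 <= 2 ^+ k :> R by rewrite exprn_ege1// ler1n.
(* The factor of lam_(2^j) in [hB] is at least min(1, h), as 2^j and 2^i are at least 1. So [hB]
   also bounds the sum of the lam_(2^j), hence by GBV the total variation, and both series
   converge. *)
pose c := Num.min 1 h.
have c0 : 0 < c by rewrite lt_min h0 ltr01.
have hsum J : \sum_(0 <= j < J) lam (2 ^ j)%N <= B / c.
  rewrite ler_pdivlMr//; apply: le_trans (hB J).
  rewrite mulr_suml; apply: ler_sum => j _.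
  apply: ler_wpM2l; first by rewrite lam_ge0// expn_gt0.
  rewrite -[leLHS]mulr1; apply: ler_pM; rewrite ?(ltW c0)//.
    have : h <= 2 ^+ j * h by rewrite ler_peMl ?two_ge1// ltW.
    by move=> hh; rewrite /c le_min !ge_min lexx hh orbT.
  by rewrite le_min !two_ge1.
have hD J : \sum_(1 <= k < 2 ^ J) `|Delta lam k| <= M * (B / c).
  apply: le_trans (_ : M * \sum_(0 <= j < J) lam (2 ^ j)%N * 1 <= _).
    apply: le_trans (gbv_dyadic_sum (fun=> 1) (fun=> 1) J _ _) => //.
    by apply: ler_sum => k _; rewrite mulr1.
  by rewrite ler_pM2l//; under eq_bigr do rewrite mulr1.
have cu : cvgn (fun N => \sum_(1 <= k < N) lam k * cos (k%:R * u)).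
  by apply: cos_series_cvg hD; rewrite u0 (le_trans uv).
have cv : cvgn (fun N => \sum_(1 <= k < N) lam k * cos (k%:R * v)).
  by apply: cos_series_cvg hD; rewrite v0.
pose S t N := \sum_(1 <= k < N.+1) lam k * cos (k%:R * t).
have Su : S u @ \oo --> cos_series lam u by move: cu; rewrite -cvg_shiftS.
have Sv : S v @ \oo --> cos_series lam v by move: cv; rewrite -cvg_shiftS.
(* The boundary term of the summation by parts stays in the majorant and vanishes in the limit. *)
have cT : (fun N => 64 * M * B + lam N.+1 * (16 / u)) @ \oo --> 64 * M * B.
  rewrite -[X in _ --> X]addr0; apply: cvgD; first exact: cvg_cst.
  by rewrite -(mul0r (16 / u)); apply: cvgMl; rewrite cvg_shiftS.
apply: ler_cvg_to (cvg_norm (cvgB Sv Su)) cT _.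
near=> N; rewrite -[X in `|X|]/(S v N - S u N) /S !sum_by_parts opprD addrACA -sumrB -mulrBr.
apply: le_trans (ler_normD _ _) _; apply: lerD; last first.
  rewrite normrM ger0_norm ?lam_ge0// ler_wpM2l ?lam_ge0//.
  apply: le_trans (ler_normB _ _) _.
  have -> : 16 / u = 8 / u + 8 / u by ring.
  apply: lerD; last by rewrite cos_sum_le_inv// u0 (le_trans uv).
  apply: le_trans (_ : 8 / v <= _); first by apply: cos_sum_le_inv; rewrite v0.
  by rewrite ler_pM2l// lef_pV2 ?posrE.
pose w k := 16 * Num.min (k%:R) u^-1 * Num.min 1 (k%:R * h).
(* Since k < 2^(j+1) and 1/u <= 2^i, each minimum in [w] is at most twice its counterpart here, and
   64 = 16 * 2 * 2. *)
pose W j := 64 * (Num.min 1 (2 ^+ j * h) * Num.min (2 ^+ j) (2 ^+ i)).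
have w0 k : 0 <= w k.
  by rewrite /w !mulr_ge0// le_min ?ler0n ?ler01 ?invr_ge0 ?mulr_ge0// ltW.
have wW j k : (2 ^ j <= k < 2 ^ j.+1)%N -> w k <= W j.
  move=> /andP[_ kj]; have k2 : k%:R <= 2 * 2 ^+ j :> R.
    by rewrite -exprS -natrX ler_nat ltnW.
  have e2 : 0 <= 2 ^+ i :> R by rewrite exprn_ge0.
  have -> : W j = 16 * (2 * Num.min (2 ^+ j) (2 ^+ i)) * (2 * Num.min 1 (2 ^+ j * h)).
    by rewrite /W; ring.
  apply: ler_pM.
  - by rewrite mulr_ge0// le_min ler0n invr_ge0 ltW.
  - by rewrite le_min ler01 mulr_ge0// ltW.
  - rewrite ler_pM2l// minr_pMr// le_min !ge_min k2 /=; apply/orP; right.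
    by apply: le_trans ui _; rewrite ler_peMl// ler1n.
  - rewrite minr_pMr// le_min !ge_min mulr1 ler1n/= mulrA.
    by rewrite (ler_pM2r h0) k2 orbT.
apply: le_trans (ler_norm_sum _ _ _) _.
apply: le_trans (_ : \sum_(1 <= k < N.+1) `|Delta lam k| * w k <= _).
  apply: ler_sum => k _; rewrite -mulrBr normrM ler_wpM2l//.
  exact: cos_sumB_le.
apply: le_trans (_ : \sum_(1 <= k < 2 ^ N) `|Delta lam k| * w k <= _).
  apply: ler_sum_nat_widen => //; first exact: ltn_expl.
  by move=> k; rewrite mulr_ge0.
apply: le_trans (gbv_dyadic_sum w W N wW _) _.
  move=> j; rewrite /W mulr_ge0// mulr_ge0// le_min ?ler01 ?mulr_ge0 ?exprn_ge0//.
  exact: ltW.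
rewrite (mulrC 64) -mulrA ler_pM2l// mulrC.
have -> : \sum_(0 <= j < N) lam (2 ^ j)%N * W j =
   (\sum_(0 <= j < N) lam (2 ^ j)%N *
     (Num.min 1 (2 ^+ j * h) * Num.min (2 ^+ j) (2 ^+ i))) * 64.
  by rewrite mulr_suml; apply: eq_bigr => j _; rewrite /W; ring.
by rewrite ler_pM2r.
Unshelve. all: by end_near. Qed.

End general_bounded_variation.

(** * Geometric kernels in l^p *)

Section power_sums.
Context {R : realType} (p : R).
Hypothesis p_gt1 : 1 < p.

Let p_gt0 : 0 < p. Proof. exact: lt_trans p_gt1. Qed.

(** This is Jensen's inequality for weights whose total mass is only bounded by S, whence the factor
    S^(p - 1). *)
Lemma powR_weighted_sum_le (w g : nat -> R) (S : R) (J : nat) :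
  0 < S -> (forall j, 0 <= w j) -> (forall j, 0 <= g j) ->
  \sum_(0 <= j < J) w j <= S ->
  (\sum_(0 <= j < J) w j * g j) `^ p <=
  S `^ (p - 1) * \sum_(0 <= j < J) w j * g j `^ p.
Proof.
move=> S0 w0 g0 wS.
set X := \sum_(0 <= j < J) w j * g j; set G := \sum_(0 <= j < J) w j * g j `^ p.
pose A := X / S.
have X0 : 0 <= X by apply: sumr_ge0 => j _; rewrite mulr_ge0.
have A0 : 0 <= A by rewrite divr_ge0// ltW.
have pB1 : 0 < p - 1 by rewrite subr_gt0.
have AA : A * A `^ (p - 1) = A `^ p by rewrite mulr_powRB1.
have XSA : X = S * A by rewrite /A mulrC divfK// gt_eqF.
pose q := p / (p - 1).
(* Young's inequality against the constant [A]; the [A]-terms cancel after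
   summation because [sum w g = S A]. *)
have young j : g j * A `^ (p - 1) <= g j `^ p / p + A `^ p / q.
  have -> : A `^ p = (A `^ (p - 1)) `^ q.
    by rewrite -powRrM /q mulrC divfK// gt_eqF.
  apply: conjugate_powR; rewrite ?powR_ge0// ?divr_gt0//.
  by rewrite /q; field; rewrite !gt_eqF.
have : X * A `^ (p - 1) <= G / p + S * (A `^ p / q).
  rewrite /X /G mulr_suml.
  apply: le_trans (_ : \sum_(0 <= j < J) (w j * (g j `^ p) / p + w j * (A `^ p / q)) <= _).
    by apply: ler_sum => j _; rewrite -!mulrA -mulrDr ler_wpM2l.
  rewrite big_split/= -!mulr_suml lerD2l ler_wpM2r//.
  by rewrite !mulr_ge0 ?powR_ge0// invr_ge0 divr_ge0// ltW.
rewrite {1}XSA -mulrA AA => h.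
(* As 1 - 1/q = 1/p, moving the A^p/q term to the left leaves S A^p / p <= G / p. *)
have {h}SG : S * A `^ p <= G.
  have e : S * A `^ p = (S * A `^ p - S * (A `^ p / q)) * p.
    by rewrite /q; field; rewrite !gt_eqF.
  by rewrite e -ler_pdivlMr//; lra.
rewrite XSA powRM ?(ltW S0)// -(@mulr_powRB1 _ S p) ?(ltW S0)//.
rewrite (mulrC S) -mulrA ler_wpM2l ?powR_ge0//.
Qed.

Lemma sum_expr_dist_le (rho : R) (i J : nat) : 0 <= rho -> rho < 1 ->
  \sum_(0 <= j < J) rho ^+ ((i - j) + (j - i)) <= 2 / (1 - rho).
Proof.
move=> r0 r1; rewrite ler_pdivlMr ?subr_gt0//.
(* The bound telescopes in [J]; the subtractions are truncated. *)
apply: le_trans (_ : rho ^+ (i - J) + (1 - rho ^+ (J - i)) <= _); last first.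
  have : rho ^+ (i - J) <= 1 by rewrite exprn_ile1// ltW.
  have : 0 <= rho ^+ (J - i) by rewrite exprn_ge0.
  lra.
elim: J => [|J IH].
  by rewrite big_geq// mul0r subn0 sub0n expr0 subrr addr0 exprn_ge0.
rewrite big_nat_recr//= mulrDl; have [Ji|iJ] := ltnP J i.
  have -> : (J - i = 0)%N by apply/eqP; rewrite subn_eq0 ltnW.
  have -> : (J.+1 - i = 0)%N by apply/eqP; rewrite subn_eq0.
  move: IH; have -> : (J - i = 0)%N by apply/eqP; rewrite subn_eq0 ltnW.
  rewrite addn0 -subSS (subSn Ji) exprS.
  have : rho * rho ^+ (i - J.+1) <= rho ^+ (i - J.+1).
    by rewrite ler_piMl ?exprn_ge0// ltW.
  have : 0 <= (rho ^+ (i - J.+1) - rho * rho ^+ (i - J.+1)) * (1 - rho).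
    by rewrite mulr_ge0 ?subr_ge0 ?ler_piMl ?exprn_ge0// ltW.
  rewrite expr0; lra.
have -> : (i - J.+1 = 0)%N by apply/eqP; rewrite subn_eq0 (leq_trans iJ).
move: IH; have -> : (i - J = 0)%N by apply/eqP; rewrite subn_eq0.
rewrite add0n (subSn iJ) exprS expr0; lra.
Qed.

(* [ratio_i ^ i * ratio_j ^ j * min (2 ^ j) (2 ^ i)] is the kernel which remains
   once the [L^p] weights are absorbed into the data; it decays geometrically
   in [|i - j|]. *)
Definition ratio_i : R := 2 `^ (- p^-1).
Definition ratio_j : R := 2 `^ (- (1 - p^-1)).
Definition ratio : R := Num.max ratio_i ratio_j.

Lemma ratio_i_gt0 : 0 < ratio_i. Proof. exact: powR_gt0. Qed.
Lemma ratio_j_gt0 : 0 < ratio_j. Proof. exact: powR_gt0. Qed.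
Lemma ratio_ge0 : 0 <= ratio.
Proof. by rewrite le_max ltW// ratio_i_gt0. Qed.

(** Both exponents, -1/p and -(1 - 1/p), are negative because 1 < p. *)
Lemma ratio_lt1 : ratio < 1.
Proof.
have two_gt1 : 1 < 2 :> R by rewrite ltr1n.
have pV : p^-1 < 1 by rewrite invf_lt1.
have two_powR (r : R) : r < 0 -> 2 `^ r < 1.
  by move=> r0; rewrite /powR gt_eqF// -[ltRHS]expR0 ltr_expR nmulr_rlt0// ln_gt0 ?ltr1n.
by rewrite gt_max !two_powR// oppr_lt0 ?invr_gt0// subr_gt0.
Qed.

Lemma ratioM : ratio_i * ratio_j * 2 = 1.
Proof.
rewrite -[X in _ * X](@powRr1 R 2)// -!powRD; last 2 first.
- by rewrite (@pnatr_eq0 R 2) implybT.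
- by rewrite (@pnatr_eq0 R 2) implybT.
by rewrite (_ : _ + _ = 0) ?powRr0//; ring.
Qed.

Lemma ratio_i_powR : ratio_i `^ p = 2^-1.
Proof. by rewrite -powRrM mulNr mulVf ?gt_eqF// powR_inv1. Qed.

Lemma ratio_j_powR : ratio_j `^ p = 2 `^ (1 - p).
Proof.
rewrite -powRrM; congr powR; field; exact: lt0r_neq0.
Qed.

(** By [ratioM] the common powers cancel against the minimum, leaving [ratio_i] to the power i - j
    if j <= i, and [ratio_j] to the power j - i otherwise. *)
Lemma ratio_kernel (i j : nat) :
  ratio_i ^+ i * ratio_j ^+ j * Num.min (2 ^+ j) (2 ^+ i) <=
  ratio ^+ ((i - j) + (j - i)).
Proof.
have i0 := ratio_i_gt0; have j0 := ratio_j_gt0.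
have [ji|ij] := leqP j i.
  have -> : (j - i = 0)%N by apply/eqP; rewrite subn_eq0.
  rewrite addn0 min_l ?ler_weXn2l ?ler1n//.
  rewrite -{1}(subnK ji) exprD -!mulrA (mulrA (_ ^+ j)) -!exprMn ratioM expr1n mulr1.
  by rewrite lerXn2r ?nnegrE ?ratio_ge0 ?(ltW i0)// le_max lexx.
have -> : (i - j = 0)%N by apply/eqP; rewrite subn_eq0 ltnW.
rewrite add0n min_r; last by rewrite ler_weXn2l ?ler1n// ltnW.
rewrite -{1}(subnK (ltnW ij)) exprD mulrCA -!mulrA (mulrA (_ ^+ i)) -!exprMn ratioM expr1n mulr1.
by rewrite lerXn2r ?nnegrE ?ratio_ge0 ?(ltW j0)// le_max lexx orbT.
Qed.

End power_sums.

(** * Dyadic weights and their convolution with the kernel *)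

Definition dyadic_weight {R : realType} (p h : R) (lam : nat -> R) (j : nat) : R :=
  lam (2 ^ j)%N * Num.min 1 (2 ^+ j * h) * (ratio_j p) ^- j.

(** This is E_i, with [dyadic_weight] as g_j, because [(ratio_j p) ^- j] is 2^(j(1 - 1/p)). Extended
    real values make it meaningful before any convergence is known. *)
Definition dyadic_conv {R : realType} (p h : R) (lam : nat -> R) (i : nat) : \bar R :=
  (\sum_(0 <= j <oo)
    (ratio p ^+ ((i - j) + (j - i)) * dyadic_weight p h lam j `^ p)%:E)%E.

Section dyadic_estimates.
Context {R : realType} (p : R) (lam : nat -> R) (M h : R).
Hypothesis p_gt1 : 1 < p.
Hypothesis lam_ge0 : forall n, (1 <= n)%N -> 0 <= lam n.
Hypothesis M_gt0 : 0 < M.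
Hypothesis lam_gbv : forall m, (1 <= m)%N ->
  \sum_(m <= n < (2 * m).+1) `|Delta lam n| <= M * lam m.
Hypothesis h_gt0 : 0 < h.

Let p_gt0 : 0 < p. Proof. exact: lt_trans p_gt1. Qed.

Lemma dyadic_weight_ge0 j : 0 <= dyadic_weight p h lam j.
Proof.
have r0 := ratio_j_gt0 p.
rewrite /dyadic_weight !mulr_ge0 ?lam_ge0 ?expn_gt0//.
  by rewrite le_min ler01 mulr_ge0 ?exprn_ge0// ltW.
by rewrite invr_ge0 exprn_ge0// ltW.
Qed.

Lemma dyadic_conv_term_ge0 i j :
  0 <= ratio p ^+ ((i - j) + (j - i)) * dyadic_weight p h lam j `^ p.
Proof. by rewrite mulr_ge0 ?powR_ge0// exprn_ge0// ratio_ge0. Qed.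

Lemma dyadic_conv_ge0 i : (0 <= dyadic_conv p h lam i)%E.
Proof. by apply: nneseries_ge0 => j _ _; rewrite lee_fin dyadic_conv_term_ge0. Qed.

(** Multiplying by [ratio_i] to the power i, that is 2^(-i/p), turns each summand into the kernel
    times g_j. The kernel bound, Jensen's inequality and a p-th root finish. *)
Lemma dyadic_sum_le_conv (i J : nat) (e : R) : dyadic_conv p h lam i = e%:E ->
  \sum_(0 <= j < J) lam (2 ^ j)%N *
     (Num.min 1 (2 ^+ j * h) * Num.min (2 ^+ j) (2 ^+ i)) <=
  (ratio_i p) ^- i * ((2 / (1 - ratio p)) `^ (p - 1) * e) `^ p^-1.
Proof.
move=> Ee; have i0 := ratio_i_gt0 p; have j0 := ratio_j_gt0 p.
have r1 := ratio_lt1 p p_gt1.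
pose w j := ratio p ^+ ((i - j) + (j - i)).
have w0 j : 0 <= w j by rewrite exprn_ge0// ratio_ge0.
have S0 : 0 < 2 / (1 - ratio p) by rewrite divr_gt0// subr_gt0.
rewrite mulrC ler_pdivlMr ?exprn_gt0//.
apply: le_trans (_ : \sum_(0 <= j < J) w j * dyadic_weight p h lam j <= _).
  rewrite mulr_suml; apply: ler_sum => j _.
  have -> : lam (2 ^ j)%N * (Num.min 1 (2 ^+ j * h) * Num.min (2 ^+ j) (2 ^+ i)) *
     ratio_i p ^+ i = ratio_i p ^+ i * ratio_j p ^+ j * Num.min (2 ^+ j) (2 ^+ i) *
     dyadic_weight p h lam j.
    rewrite /dyadic_weight; field.
    by rewrite expf_neq0// gt_eqF.
  by rewrite ler_wpM2r ?dyadic_weight_ge0// ratio_kernel.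
set X := \sum_(0 <= j < J) _.
have X0 : 0 <= X.
  by apply: sumr_ge0 => j _; rewrite mulr_ge0 ?dyadic_weight_ge0.
have : X `^ p <= (2 / (1 - ratio p)) `^ (p - 1) * e.
  apply: le_trans (powR_weighted_sum_le p p_gt1 w _ _ J S0 w0 dyadic_weight_ge0 _) _.
    by apply: sum_expr_dist_le; rewrite ?ratio_ge0.
  rewrite ler_wpM2l ?powR_ge0// -lee_fin -Ee -sumEFin.
  by apply: nneseries_lim_ge => j _ _; rewrite lee_fin dyadic_conv_term_ge0.
move=> Xe; rewrite -[leLHS](_ : (X `^ p) `^ p^-1 = X).
  by apply: ge0_ler_powR; rewrite ?invr_ge0 ?(ltW p_gt0)// nnegrE ?powR_ge0//
    (le_trans _ Xe)// powR_ge0.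
by rewrite -powRrM mulfV ?gt_eqF// powRr1.
Qed.

Hypothesis lam_cvg0 : lam @ \oo --> (0 : R).

Lemma cos_seriesB_powR_le (u v : R) (i : nat) :
  0 < u -> u <= v -> v <= pi -> v - u <= h -> u^-1 <= 2 ^+ i ->
  ((`|cos_series lam v - cos_series lam u| `^ p)%:E <=
    ((64 * M) `^ p * (2 / (1 - ratio p)) `^ (p - 1) * 2 ^+ i)%:E *
    dyadic_conv p h lam i)%E.
Proof.
move=> u0 uv vpi vuh ui.
have r1 := ratio_lt1 p p_gt1; have i0 := ratio_i_gt0 p.
have S0 : 0 < 2 / (1 - ratio p) by rewrite divr_gt0// subr_gt0.
have C0 : 0 < (64 * M) `^ p * (2 / (1 - ratio p)) `^ (p - 1) * 2 ^+ i.
  by rewrite !mulr_gt0 ?powR_gt0 ?exprn_gt0// mulr_gt0.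
(* If E_i is infinite, the right-hand side is [+oo]; the rest treats a real E_i. *)
have := dyadic_conv_ge0 i; case E : (dyadic_conv p h lam i) => [e| |]// e0; last first.
  by rewrite gt0_muley ?leey// lte_fin.
have := cos_seriesB_le lam M lam_ge0 M_gt0 lam_gbv lam_cvg0 u v h _ i
  u0 uv vpi vuh h_gt0 ui (fun J => dyadic_sum_le_conv i J e E).
set B := _ ^- i * _ => H.
rewrite -EFinM lee_fin.
have e0' : 0 <= (2 / (1 - ratio p)) `^ (p - 1) * e by rewrite mulr_ge0 ?powR_ge0.
have B0 : 0 <= B by rewrite mulr_ge0 ?powR_ge0// invr_ge0 exprn_ge0// ltW.
have -> : (64 * M) `^ p * (2 / (1 - ratio p)) `^ (p - 1) * 2 ^+ i * e =
  (64 * M * B) `^ p.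
  have M64 : 0 <= 64 * M by rewrite mulr_ge0// ltW.
  have ri : 0 <= ratio_i p ^- i by rewrite invr_ge0 exprn_ge0// ltW.
  rewrite [RHS](powRM _ M64 B0) [in RHS](powRM _ ri (powR_ge0 _ _)).
  rewrite -!powRrM mulVf ?gt_eqF// powRr1//.
  have -> : (ratio_i p ^- i) `^ p = 2 ^+ i.
    rewrite -powR_invn ?(ltW i0)// -powRrM mulrC powRrM ratio_i_powR//.
    by rewrite powR_invn// exprVn invrK.
  by rewrite -!mulrA; congr (_ * _); rewrite mulrCA mulrA.
apply: ge0_ler_powR; rewrite ?(ltW p_gt0)// nnegrE// mulr_ge0// mulr_ge0//.
exact: ltW.
Qed.

Lemma dyadic_weight_powR (x : R) (j : nat) : 0 <= x ->
  (x * (ratio_j p) ^- j) `^ p = x `^ p * 2 `^ ((p - 1) * j%:R).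
Proof.
move=> x0; have j0 := ratio_j_gt0 p.
have rj : 0 <= ratio_j p ^- j by rewrite invr_ge0 exprn_ge0// ltW.
rewrite (powRM _ x0 rj) -(powR_invn _ (ltW j0)) -powRrM.
rewrite (_ : - j%:R * p = p * - j%:R); last by ring.
rewrite powRrM (ratio_j_powR _ p_gt1) -powRrM.
by rewrite (_ : (1 - p) * - j%:R = (p - 1) * j%:R)//; ring.
Qed.

Let coef k := (k%:R : R) `^ (p - 2) * (lam k * Num.min 1 (k%:R * h)) `^ p.

(** The weight at j + 1 is compared with the preceding block because quasi-monotonicity bounds
    lam_(2^(j+1)) only by earlier terms. *)
Lemma dyadic_weight_block (j : nat) : dyadic_weight p h lam j.+1 `^ p <=
  (2 * (1 + M)) `^ p * 2 `^ (p + 1) * \sum_(2 ^ j <= k < 2 ^ j.+1) coef k.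
Proof.
have e2 : 0 < 2 ^+ j :> R by rewrite exprn_gt0.
have M1 : 0 <= 1 + M by rewrite addr_ge0// ltW.
set C := _ * 2 `^ _.
(* Summing a bound valid for each of the 2^j indices of the block gives the claim. *)
suff H k : (2 ^ j <= k < 2 ^ j.+1)%N ->
    dyadic_weight p h lam j.+1 `^ p <= C * (2 ^+ j * coef k).
  rewrite -(ler_pM2l e2).
  have -> : 2 ^+ j * dyadic_weight p h lam j.+1 `^ p =
     \sum_(2 ^ j <= k < 2 ^ j.+1) dyadic_weight p h lam j.+1 `^ p.
    by rewrite sumr_const_nat expnS mul2n -addnn addnK -[RHS]mulr_natl natrX.
  have -> : 2 ^+ j * (C * \sum_(2 ^ j <= k < 2 ^ j.+1) coef k) =
     \sum_(2 ^ j <= k < 2 ^ j.+1) C * (2 ^+ j * coef k).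
    by rewrite mulrCA !mulr_sumr.
  exact: ler_sum_nat.
move=> /andP[jk kj].
have k0 : (0 < k)%N by rewrite (leq_trans _ jk)// expn_gt0.
have kR : 0 < k%:R :> R by rewrite ltr0n.
have jkR : 2 ^+ j <= k%:R :> R by rewrite -natrX ler_nat.
have kjR : k%:R <= 2 ^+ j.+1 :> R by rewrite -natrX ler_nat ltnW.
have x0 : 0 <= lam k * Num.min 1 (k%:R * h).
  by rewrite mulr_ge0 ?lam_ge0// le_min ler01 mulr_ge0// ltW.
have m0 : 0 <= Num.min 1 (2 ^+ j.+1 * h).
  by rewrite le_min ler01 mulr_ge0 ?exprn_ge0// ltW.
have l1 : lam (2 ^ j.+1)%N <= (1 + M) * lam k.
  apply: (gbv_quasi_decr lam M lam_gbv) => //; rewrite (ltnW kj)/=.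
  by rewrite expnS ltnW// ltnS leq_mul2l.
have l2 : Num.min 1 (2 ^+ j.+1 * h) <= 2 * Num.min 1 (k%:R * h).
  rewrite minr_pMr// le_min !ge_min mulr1 ler1n/= mulrA.
  by rewrite (ler_pM2r h_gt0) exprS (ler_pM2l (ltr0n R 2)) jkR orbT.
have l3 : lam (2 ^ j.+1)%N * Num.min 1 (2 ^+ j.+1 * h) <=
    2 * (1 + M) * (lam k * Num.min 1 (k%:R * h)).
  apply: le_trans (ler_pM _ m0 l1 l2) _; first by rewrite lam_ge0// expn_gt0.
  by rewrite le_eqVlt; apply/orP; left; apply/eqP; ring.
rewrite /dyadic_weight dyadic_weight_powR ?mulr_ge0 ?lam_ge0 ?expn_gt0//.
apply: le_trans (_ : (2 * (1 + M) * (lam k * Num.min 1 (k%:R * h))) `^ p *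
   2 `^ ((p - 1) * j.+1%:R) <= _).
  rewrite ler_wpM2r ?powR_ge0//; apply: ge0_ler_powR => //; rewrite ?(ltW p_gt0)//.
    by rewrite nnegrE mulr_ge0// lam_ge0// expn_gt0.
  by rewrite nnegrE mulr_ge0// mulr_ge0.
have c0 : 0 <= 2 * (1 + M) by rewrite mulr_ge0.
rewrite (powRM _ c0 x0) /C /coef.
set A := (2 * (1 + M)) `^ p; set B := (lam k * _) `^ p.
have -> : A * 2 `^ (p + 1) * (2 ^+ j * (k%:R `^ (p - 2) * B)) =
  A * B * (2 `^ (p + 1) * 2 ^+ j * k%:R `^ (p - 2)) by ring.
rewrite ler_wpM2l ?mulr_ge0 ?powR_ge0//.
have two0 : (2 : R) != 0 by rewrite pnatr_eq0.
(* The sign of p - 2 is unknown, so k^p is bounded below by k >= 2^j and k^2 above by k <=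
   2^(j+1). *)
have kp : 2 `^ (p * j%:R) / 2 `^ (2 * (j%:R + 1)) <= k%:R `^ (p - 2).
  have -> : k%:R `^ (p - 2) = k%:R `^ p / k%:R `^ 2.
    by rewrite powRB//; apply/implyP => _; rewrite gt_eqF.
  apply: ler_pM; rewrite ?invr_ge0 ?powR_ge0//.
    rewrite (mulrC p) powRrM powR_mulrn//.
    by apply: ge0_ler_powR; rewrite ?nnegrE ?(ltW p_gt0) ?(ltW e2) ?(ltW kR).
  rewrite lef_pV2 ?posrE ?powR_gt0//.
  have -> : 2 `^ (2 * (j%:R + 1)) = (2 ^+ j.+1) `^ 2 :> R.
    by rewrite (mulrC 2) powRrM natr1 (powR_mulrn j.+1).
  by apply: ge0_ler_powR; rewrite ?nnegrE ?(ltW kR)// exprn_ge0.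
apply: le_trans (ler_wpM2l _ kp); last by rewrite mulr_ge0 ?powR_ge0 ?(ltW e2).
rewrite -powR_mulrn// -powRN -!powRD ?two0 ?implybT//.
(* The exponents agree: (p + 1) + j + pj - 2(j + 1) = (p - 1)(j + 1). *)
by rewrite le_eqVlt; apply/orP; left; apply/eqP; congr powR; rewrite -natr1; ring.
Qed.

Lemma sum_dyadic_weight_le (J : nat) :
  \sum_(0 <= j < J) dyadic_weight p h lam j `^ p <=
  (1 + (2 * (1 + M)) `^ p * 2 `^ (p + 1)) * \sum_(1 <= k < 2 ^ J) coef k.
Proof.
have coef0 k : 0 <= coef k by rewrite mulr_ge0 ?powR_ge0.
case: J => [|J]; first by rewrite !big_geq// mulr0.
rewrite big_nat_recl// mulrDl mul1r; apply: lerD.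
  (* The weight of index 0 has no preceding block; its p-th power is [coef 1], which accounts for
     the summand 1 in the constant. *)
  apply: le_trans (_ : \sum_(1 <= k < 2) coef k <= _).
    rewrite big_nat1 /coef /dyadic_weight expn0 expr0 powR1 !mul1r invr1 mulr1 //.
  by apply: ler_sum_nat_widen => //; rewrite expnS leq_pmulr// expn_gt0.
set C := _ * 2 `^ _.
apply: le_trans (_ : C * \sum_(1 <= k < 2 ^ J) coef k <= _); last first.
  rewrite ler_wpM2l ?mulr_ge0 ?powR_ge0//.
  by apply: ler_sum_nat_widen; rewrite ?expn_gt0// leq_exp2l.
rewrite big_nat_dyadic mulr_sumr; apply: ler_sum => j _.
exact: dyadic_weight_block.
Qed.

End dyadic_estimates.

(** * Integrals of sums of bumps *)

(** The integral of a nonnegative function is a supremum over simple functions below it, so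
    monotonicity needs no measurability. Thus the increment of the cosine series can be integrated
    against a measurable majorant only. *)
Lemma ge0_le_integral_nonmeas {d} {T : measurableType d} {R : realType}
    (mu : {measure set T -> \bar R}) (D : set T) (f g : T -> \bar R) :
  (forall x, D x -> 0 <= f x)%E -> (forall x, D x -> f x <= g x)%E ->
  (\int[mu]_(x in D) f x <= \int[mu]_(x in D) g x)%E.
Proof.
move=> f0 fg.
have g0 x : D x -> (0 <= g x)%E by move=> Dx; rewrite (le_trans (f0 x Dx)) ?fg.
rewrite !ge0_integralE//; apply: le_ereal_sup => _ [s /= sf <-].
exists s => //= x; apply: le_trans (sf x) _.
rewrite !patchE; case: ifPn => // /set_mem; exact: fg.
Qed.

(** This gives a measurable majorant with a singularity at z; heights are extended reals so that
    [+oo] is allowed at z itself. *)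
Definition bumps {R : realType} (c : nat -> \bar R) (r : nat -> R) (z x : R) : \bar R :=
  (\sum_(0 <= i <oo) c i * (\1_`[z - r i, z + r i] x)%:E)%E.

Section bumps.
Context {R : realType} (c : nat -> \bar R) (r : nat -> R).
Hypothesis c_ge0 : forall i, (0 <= c i)%E.
Hypothesis r_ge0 : forall i, 0 <= r i.
Local Notation mu := (@lebesgue_measure R).

Let bump_ge0 (z x : R) i : (0 <= c i * (\1_`[z - r i, z + r i] x)%:E)%E.
Proof. by rewrite mule_ge0// lee_fin. Qed.

Lemma bumps_ge0 (z x : R) : (0 <= bumps c r z x)%E.
Proof. by apply: nneseries_ge0 => i _ _; exact: bump_ge0. Qed.

Lemma bumps_ge (z x : R) (i : nat) : `|x - z| <= r i -> (c i <= bumps c r z x)%E.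
Proof.
move=> xz.
have -> : c i = (c i * (\1_`[z - r i, z + r i] x)%:E)%E.
  rewrite indicE mem_set ?mule1//= in_itv/=.
  by move: xz; rewrite ler_norml => /andP[? ?]; apply/andP; split; lra.
apply: le_trans (nneseries_lim_ge i.+1 _); last by move=> j _ _; exact: bump_ge0.
by rewrite big_nat_recr//= leeDr// sume_ge0.
Qed.

Let measurable_bump (D : set R) (z : R) i : measurable_fun D
  (fun x : R => c i * (\1_`[z - r i, z + r i] x)%:E)%E.
Proof.
apply: measurable_funeM; apply/measurable_EFinP.
exact/measurable_indic.
Qed.

Lemma measurable_bumps (D : set R) (z : R) : measurable_fun D (bumps c r z).
Proof.
apply: ge0_emeasurable_sum => //= i _; exact: measurable_bump.
Qed.

Lemma integral_bumps_le (D : set R) (z : R) : measurable D ->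
  (\int[mu]_(x in D) bumps c r z x <=
   \sum_(0 <= i <oo) c i * (2 * r i)%:E)%E.
Proof.
move=> mD; rewrite /bumps integral_nneseries//; last by move=> i; exact: measurable_bump.
apply: lee_nneseries => [i _ _|i _].
  by apply: integral_ge0 => x _; exact: bump_ge0.
rewrite ge0_integralZl//; last exact/measurable_EFinP/measurable_indic.
rewrite integral_indic//.
apply: lee_wpmul2l => //.
apply: (@le_trans _ _ (mu `[z - r i, z + r i])).
  by apply: le_measure; rewrite ?inE; [exact: measurableI|exact: measurable_itv|exact: subIsetl].
rewrite lebesgue_measure_itv/=; case: ifPn => _; last by rewrite lee_fin mulr_ge0.
by rewrite -EFinB lee_fin; lra.

Qed.

End bumps.

(** * The L^p norm of an increment *)

Lemma eq_cos_series {R : realType} (lam : nat -> R) (x y : R) :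
  (forall n : nat, cos (n%:R * x) = cos (n%:R * y)) ->
  cos_series lam x = cos_series lam y.
Proof.
move=> xy; rewrite /cos_series; congr (limn _); apply/funext => N.
by apply: eq_bigr => n _; rewrite xy.
Qed.

Lemma cos_seriesB2pi {R : realType} (lam : nat -> R) (x : R) :
  cos_series lam (x - 2 * pi) = cos_series lam x.
Proof.
apply: eq_cos_series => n.
rewrite -[LHS](periodicn (@cosD2pi R) n); congr cos.
by rewrite -mulr_natl; ring.
Qed.

Lemma cos_seriesN {R : realType} (lam : nat -> R) (x : R) :
  cos_series lam (- x) = cos_series lam x.
Proof. by apply: eq_cos_series => n; rewrite mulrN cosN. Qed.

Lemma cos_series2piB {R : realType} (lam : nat -> R) (x : R) :
  cos_series lam (2 * pi - x) = cos_series lam x.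
Proof. by rewrite -cos_seriesN opprB cos_seriesB2pi. Qed.

(** Reflection and periodicity carry x and x + t into [0, pi], and a is the smaller image. The
    centres z are the points where x or x + t meets a multiple of 2 pi; they are excluded since a
    would be 0 there. *)
Lemma cos_series_fold {R : realType} (lam : nat -> R) (x t : R) :
  0 < t <= 1 -> 0 <= x <= 2 * pi -> x != 0 -> x != 2 * pi -> x != 2 * pi - t ->
  exists z a b : R, [/\ z \in [:: 0; 2 * pi; 2 * pi - t], `|x - z| = a,
    [&& 0 < a, a <= b, b <= pi & b - a <= t] &
    `|cos_series lam (x + t) - cos_series lam x| =
    `|cos_series lam b - cos_series lam a| ].
Proof.
move=> /andP[t0 t1] /andP[x0 x2] xn0 xn2 xnt.
have pi2 := pi_ge2 R.
have {x0 xn0} x0 : 0 < x by rewrite lt_neqAle eq_sym xn0.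
have {x2 xn2} x2 : x < 2 * pi by rewrite lt_neqAle xn2.
have mem0 : 0 \in [:: 0; 2 * pi; 2 * pi - t] by rewrite !inE eqxx.
have mem2 : 2 * pi \in [:: 0; 2 * pi; 2 * pi - t] by rewrite !inE eqxx orbT.
have memt : 2 * pi - t \in [:: 0; 2 * pi; 2 * pi - t] by rewrite !inE eqxx !orbT.
have [xpi|pix] := leP x pi.
  have [xtpi|pixt] := leP (x + t) pi.
    exists 0, x, (x + t); split => //; last by apply/and4P; split; lra.
    by rewrite subr0 gtr0_norm.
  rewrite -(cos_series2piB lam (x + t)).
  have [le|lt] := leP x (2 * pi - (x + t)).
    exists 0, x, (2 * pi - (x + t)); split => //.
    - by rewrite subr0 gtr0_norm.
    - by apply/and4P; split; lra.
  exists (2 * pi - t), (2 * pi - (x + t)), x; split => //.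
  - by rewrite distrC gtr0_norm; lra.
  - by apply/and4P; split; lra.
  - by rewrite distrC.
rewrite -(cos_series2piB lam x).
have [xt|] := ltP (x + t) (2 * pi).
  rewrite -(cos_series2piB lam (x + t)).
  exists (2 * pi - t), (2 * pi - (x + t)), (2 * pi - x); split => //.
  - by rewrite distrC gtr0_norm; lra.
  - by apply/and4P; split; lra.
  - by rewrite distrC.
rewrite le_eqVlt => /orP[/eqP e|xt].
  by move: xnt; rewrite e addrK eqxx.
rewrite -(cos_seriesB2pi lam (x + t)).
have [le|lt] := leP (2 * pi - x) (x + t - 2 * pi).
  exists (2 * pi), (2 * pi - x), (x + t - 2 * pi); split => //.
  - by rewrite distrC gtr0_norm; lra.
  - by apply/and4P; split; lra.
exists (2 * pi - t), (x + t - 2 * pi), (2 * pi - x); split => //.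
- by rewrite gtr0_norm; lra.
- by apply/and4P; split; lra.
- by rewrite distrC.
Qed.

(** Take the least i with 1/a <= 2^i. For i > 0 minimality gives even a <= 2/2^i; for i = 0 the
    assumption a <= 4 is the bound. *)
Lemma dyadic_scale {R : realType} (a : R) : 0 < a <= 4 ->
  exists i : nat, a^-1 <= 2 ^+ i /\ a <= 4 / 2 ^+ i.
Proof.
move=> /andP[a0 a4].
have ex : exists i, a^-1 <= 2 ^+ i.
  exists (Num.truncn a^-1).+1; apply: le_trans (ltW (truncnS_gt _)) _.
  by rewrite -natrX ler_nat ltnW// ltn_expl.
exists (ex_minn ex); case: ex_minnP => -[|i] ai imin; split => //.
  by rewrite expr0 divr1.
have : 2 ^+ i < a^-1.
  by rewrite ltNge; apply/negP => /imin; rewrite ltnn.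
have e2 : 0 < 2 ^+ i :> R by rewrite exprn_gt0.
rewrite -ltf_pV2 ?posrE ?invr_gt0// invrK => /ltW le.
apply: le_trans le _; rewrite exprS invfM.
have : 0 < (2 ^+ i)^-1 :> R by rewrite invr_gt0.
lra.
Qed.

(* The bump of index 0 has height [+oo] and radius 0: it covers the point where
   the series may diverge and does not contribute to the integral. *)
Definition bump_height {R : realType} (p h : R) (lam : nat -> R) (i : nat) : \bar R :=
  if i is i'.+1 then ((2 ^+ i')%:E * dyadic_conv p h lam i')%E else +oo%E.

Definition bump_radius {R : realType} (i : nat) : R :=
  if i is i'.+1 then 4 / 2 ^+ i' else 0.

Section modulus_of_continuity.
Context {R : realType} (p : R) (lam : nat -> R) (M h : R).
Hypothesis p_gt1 : 1 < p.
Hypothesis lam_ge0 : forall n, (1 <= n)%N -> 0 <= lam n.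
Hypothesis M_gt0 : 0 < M.
Hypothesis lam_gbv : forall m, (1 <= m)%N ->
  \sum_(m <= n < (2 * m).+1) `|Delta lam n| <= M * lam m.
Hypothesis lam_cvg0 : lam @ \oo --> (0 : R).
Hypothesis h_gt0 : 0 < h.
Hypothesis h_le1 : h <= 1.
Local Notation mu := (@lebesgue_measure R).

Lemma bump_height_ge0 i : (0 <= bump_height p h lam i)%E.
Proof.
case: i => [|i]//=; apply: mule_ge0; first by rewrite lee_fin exprn_ge0.
exact: dyadic_conv_ge0.
Qed.

Lemma bump_radius_ge0 i : 0 <= bump_radius i :> R.
Proof. by case: i => [|i]//=; rewrite divr_ge0// exprn_ge0. Qed.

(** The term of index 0 is [+oo] times 0, which is 0. In the others 2^i * 2 * (4/2^i) = 8. *)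
Lemma sum_bump_height_radius :
  (\sum_(0 <= i <oo) bump_height p h lam i * (2 * bump_radius i)%:E =
   8%:E * \sum_(0 <= i <oo) dyadic_conv p h lam i)%E.
Proof.
have ge0 i : (0 <= bump_height p h lam i * (2 * bump_radius i)%:E)%E.
  by rewrite mule_ge0 ?bump_height_ge0// lee_fin mulr_ge0 ?bump_radius_ge0.
rewrite [LHS]nneseries_recl//= mulr0 mule0 add0e -(nneseries_addn 1)//.
rewrite -nneseriesZl; last by move=> i _; exact: dyadic_conv_ge0.
apply: eq_eseriesr => i _; rewrite addn1/= muleAC -EFinM; congr (_%:E * _)%E.
by field; rewrite expf_neq0// pnatr_eq0.
Qed.

(** After interchanging the nonnegative sums, the symmetric kernel is summed over i for fixed j. *)
Lemma sum_dyadic_conv_le :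
  (\sum_(0 <= i <oo) dyadic_conv p h lam i <=
   (2 / (1 - ratio p))%:E *
   \sum_(0 <= j <oo) (dyadic_weight p h lam j `^ p)%:E)%E.
Proof.
have r1 := ratio_lt1 p p_gt1.
rewrite /dyadic_conv nneseries_interchange; last first.
  by move=> i j; rewrite lee_fin dyadic_conv_term_ge0.
rewrite -nneseriesZl; last by move=> j _; rewrite lee_fin powR_ge0.
apply: lee_nneseries => [j _ _|j _].
  by apply: nneseries_ge0 => i _ _; rewrite lee_fin dyadic_conv_term_ge0.
apply: lime_le.
  by apply: is_cvg_nneseries => i _ _; rewrite lee_fin dyadic_conv_term_ge0.
apply: nearW => N; rewrite sumEFin -EFinM lee_fin -mulr_suml.
rewrite ler_wpM2r ?powR_ge0//.
under eq_bigr do rewrite addnC.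
by apply: sum_expr_dist_le; rewrite ?ratio_ge0.
Qed.

Lemma sum_dyadic_weight_eseries_le :
  (\sum_(0 <= j <oo) (dyadic_weight p h lam j `^ p)%:E <=
  (1 + (2 * (1 + M)) `^ p * 2 `^ (p + 1))%:E *
  \sum_(1 <= k <oo) ((k%:R : R) `^ (p - 2) *
     (lam k * Num.min 1 (k%:R * h)) `^ p)%:E)%E.
Proof.
apply: lime_le.
  by apply: is_cvg_nneseries => j _ _; rewrite lee_fin powR_ge0.
apply: nearW => N; rewrite sumEFin.
have := sum_dyadic_weight_le p lam M h p_gt1 lam_ge0 M_gt0 lam_gbv h_gt0 N.
rewrite -lee_fin => /le_trans; apply.
rewrite EFinM lee_wpmul2l//.
  by rewrite lee_fin addr_ge0// mulr_ge0 ?powR_ge0.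
rewrite -sumEFin; apply: nneseries_lim_ge => k _ _.
by rewrite lee_fin mulr_ge0 ?powR_ge0.
Qed.

Lemma Lp_diff_integral_le (t : R) : 0 < t <= h ->
  (\int[mu]_(x in `[0%R, (2 * pi)%R])
     (`|cos_series lam (x + t) - cos_series lam x| `^ p)%:E <=
   ((64 * M) `^ p * (2 / (1 - ratio p)) `^ (p - 1))%:E *
   (24%:E * \sum_(0 <= i <oo) dyadic_conv p h lam i))%E.
Proof.
move=> /andP[t0 th].
set K := (64 * M) `^ p * _.
have r1 := ratio_lt1 p p_gt1.
have K0 : 0 < K.
  by apply: mulr_gt0; apply: powR_gt0; rewrite mulr_gt0// invr_gt0 subr_gt0.
pose T z := bumps (bump_height p h lam) bump_radius z.
have T0 z x : (0 <= T z x)%E by apply: bumps_ge0; exact: bump_height_ge0.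
have mT z : measurable_fun `[0%R, 2 * pi] (T z : R -> \bar R).
  by apply: measurable_bumps; exact: bump_height_ge0.
(* One family of bumps for each centre in [cos_series_fold]; each integrates to at most 8 times the
   sum of the E_i, whence 24. *)
pose G x := (K%:E * (T 0%R x + (T (2 * pi)%R x + T (2 * pi - t)%R x)))%E.
have G0 x : (0 <= G x)%E by rewrite mule_ge0 ?lee_fin ?(ltW K0)// !adde_ge0.
apply: (@le_trans _ _ (\int[mu]_(x in `[0%R, (2 * pi)%R]) G x)%E).
  apply: ge0_le_integral_nonmeas => x /=; first by rewrite lee_fin powR_ge0.
  rewrite in_itv/= => x02.
  suff [z [zin H]] : exists z, z \in [:: 0; 2 * pi; 2 * pi - t] /\
      ((`|cos_series lam (x + t) - cos_series lam x| `^ p)%:E <= K%:E * T z x)%E.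
    apply: le_trans H _; rewrite lee_wpmul2l ?lee_fin ?(ltW K0)//.
    move: zin; rewrite !inE => /or3P[] /eqP ->.
    - by rewrite leeDl// adde_ge0.
    - by rewrite addeCA leeDl// adde_ge0.
    - by rewrite addeA leeDr// adde_ge0.
  have exceptional z : x = z -> T z x = +oo%E.
    move=> xz; apply/eqP; rewrite -leye_eq.
    by apply: (bumps_ge _ _ bump_height_ge0 z x 0); rewrite xz subrr normr0.
  have infty z : x = z -> z \in [:: 0; 2 * pi; 2 * pi - t] ->
      exists z, z \in [:: 0; 2 * pi; 2 * pi - t] /\
      ((`|cos_series lam (x + t) - cos_series lam x| `^ p)%:E <= K%:E * T z x)%E.
    move=> xz zin; exists z; split => //.
    by rewrite exceptional// gt0_muley ?leey// lte_fin.
  have [x0|xn0] := eqVneq x 0; first by apply: infty x0 _; rewrite !inE eqxx.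
  have [x2|xn2] := eqVneq x (2 * pi).
    by apply: infty x2 _; rewrite !inE eqxx orbT.
  have [xt|xnt] := eqVneq x (2 * pi - t).
    by apply: infty xt _; rewrite !inE eqxx !orbT.
  have [|z [a [b [zin az /and4P[a0 ab bpi bat] ->]]]] :=
    cos_series_fold lam x t _ x02 xn0 xn2 xnt.
    by rewrite t0 (le_trans th).
  exists z; split => //.
  (* The scale i gives both 1/a <= 2^i for the pointwise estimate and |x - z| = a <= 4/2^i, so that
     x lies under the bump of index i + 1. *)
  have [|i [ai ia]] := dyadic_scale a.
    by rewrite a0 (le_trans ab)// (le_trans bpi)//; have := pihalf_lt2 R; lra.
  have := cos_seriesB_powR_le p lam M h p_gt1 lam_ge0 M_gt0 lam_gbv h_gt0
    lam_cvg0 a b i a0 ab bpi (le_trans bat th) ai.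
  rewrite -/K EFinM -muleA => /le_trans; apply.
  rewrite lee_wpmul2l ?lee_fin ?(ltW K0)//.
  by apply: (bumps_ge _ _ bump_height_ge0 z x i.+1); rewrite az.
rewrite /G ge0_integralZl//; last 3 first.
- by apply: emeasurable_funD (mT _) _; apply: emeasurable_funD (mT _) (mT _).
- by move=> x _; rewrite !adde_ge0.
- by rewrite lee_fin ltW.
rewrite lee_wpmul2l ?lee_fin ?(ltW K0)//.
rewrite ge0_integralD//; last 3 first.
- exact: mT.
- by move=> x _; rewrite adde_ge0.
- exact: emeasurable_funD (mT _) (mT _).
rewrite ge0_integralD//; [|exact: mT|exact: mT].
have b z : (\int[mu]_(x in `[0%R, (2 * pi)%R]) T z x <=
    8%:E * \sum_(0 <= i <oo) dyadic_conv p h lam i)%E.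
  rewrite -sum_bump_height_radius; apply: integral_bumps_le => //.
  - exact: bump_height_ge0.
  - exact: bump_radius_ge0.
apply: le_trans (leeD (b _) (leeD (b _) (b _))) _.
have s0 : (0 <= \sum_(0 <= i <oo) dyadic_conv p h lam i)%E.
  by apply: nneseries_ge0 => i _ _; exact: dyadic_conv_ge0.
rewrite -!ge0_muleDl ?lee_fin// -!EFinD.
by rewrite le_eqVlt; apply/orP; left; apply/eqP; congr (_%:E * _)%E; ring.
Qed.

End modulus_of_continuity.

(** * Return to the sums of the theorem *)

Section weighted_series.
Context {R : realType} (p : R) (lam : nat -> R).
Hypothesis lam_ge0 : forall n, (1 <= n)%N -> 0 <= lam n.

(** The minimum is k/n below n, where it turns k^(p - 2) into n^(-p) k^(2p - 2), and 1 from n on. *)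
Lemma weighted_series_split (n : nat) : (1 <= n)%N ->
  (\sum_(1 <= k <oo) ((k%:R : R) `^ (p - 2) *
     (lam k * Num.min 1 (k%:R * n%:R^-1)) `^ p)%:E =
   (n%:R `^ (- p) *
      \sum_(1 <= k < n) ((k%:R : R) `^ (2 * p - 2) * lam k `^ p))%:E +
   \sum_(n <= k <oo) ((k%:R : R) `^ (p - 2) * lam k `^ p)%:E)%E.
Proof.
move=> n1; have nR : 0 < n%:R :> R by rewrite ltr0n.
rewrite (nneseries_split 1%N n.-1); last first.
  by move=> k _; rewrite lee_fin mulr_ge0 ?powR_ge0.
rewrite add1n prednK//; congr (_ + _)%E; last first.
  congr (limn _); apply/funext => N; rewrite big_nat [RHS]big_nat.
  apply: eq_bigr => k /andP[nk _].
  by rewrite min_l ?mulr1// ler_pdivlMr// mul1r ler_nat.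
rewrite sumEFin mulr_sumr; congr (_%:E); rewrite big_nat [RHS]big_nat.
apply: eq_bigr => k /andP[k1 kn].
have kR : 0 < k%:R :> R by rewrite ltr0n.
rewrite min_r; last by rewrite ler_pdivrMr// mul1r ler_nat ltnW.
rewrite mulrA powRM ?mulr_ge0 ?lam_ge0//.
rewrite powRM ?lam_ge0// -(@powR_inv1 _ n%:R)// -powRrM mulN1r.
have -> : k%:R `^ (2 * p - 2) = k%:R `^ (p - 2) * k%:R `^ p.
  rewrite -powRD; last by apply/implyP => _; rewrite gt_eqF.
  by congr powR; ring.
ring.
Qed.

End weighted_series.

(** Since a + Y is at most twice the larger term, monotonicity of the p-th root is enough to
    separate the two terms. *)
Lemma poweR_add_le {R : realType} (p K a : R) (Y : \bar R) :
  0 < p -> 0 < K -> 0 <= a -> (0 <= Y)%E ->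
  (poweR (K%:E * (a%:E + Y)) p^-1 <=
   ((2 * K) `^ p^-1 * a `^ p^-1)%:E + ((2 * K) `^ p^-1)%:E * poweR Y p^-1)%E.
Proof.
move=> p0 K0 a0; case: Y => [y| |]// y0; last first.
  rewrite [in leRHS]poweRyr ?gt_eqF ?invr_gt0//.
  by rewrite [in leRHS]gt0_muley ?lte_fin ?powR_gt0 ?mulr_gt0// leey.
rewrite lee_fin in y0.
rewrite -EFinD -EFinM !poweR_EFin -EFinM -EFinD lee_fin.
have pV : 0 <= p^-1 by rewrite invr_ge0 ltW.
have K2 : 0 <= 2 * K by rewrite mulr_ge0// ltW.
have ler_p x y' : 0 <= x -> x <= y' -> x `^ p^-1 <= y' `^ p^-1.
  by move=> x0 xy; apply: ge0_ler_powR; rewrite // nnegrE// (le_trans x0).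
rewrite -!powRM//.
have Ka : 0 <= K * (a + y) by rewrite mulr_ge0 ?addr_ge0// ltW.
have [ay|ya] := leP a y.
  apply: le_trans (ler_p _ (2 * K * y) Ka _) _; last by rewrite lerDr powR_ge0.
  have : K * a <= K * y by rewrite ler_pM2l.
  lra.
apply: le_trans (ler_p _ (2 * K * a) Ka _) _; last by rewrite lerDl powR_ge0.
have : K * y <= K * a by rewrite ler_pM2l// ltW.
lra.
Qed.

Theorem theorem2p3 (R : realType) (p : R) (lam : nat -> R) :
  1 < p -> GBV lam ->
  (\sum_(1 <= k <oo) (((k%:R : R) `^ (p - 2) * lam k `^ p)%:E) < +oo)%E ->
  exists C : R, 0 < C /\
    forall n : nat, (1 <= n)%N ->
      (modcont p (cos_series lam) (n%:R^-1) <=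
       (C * n%:R^-1 *
          (\sum_(1 <= k < n) ((k%:R : R) `^ (2 * p - 2) * lam k `^ p)) `^ p^-1)%:E
       + C%:E * poweR (\sum_(n <= k <oo) (((k%:R : R) `^ (p - 2) * lam k `^ p)%:E))
                      p^-1)%E.
Proof.
move=> p_gt1 [lam_ge0 [lam_cvg0 [M [M_gt0 lam_gbv]]]] _.
have p_gt0 : 0 < p by exact: lt_trans p_gt1.
have r1 := ratio_lt1 p p_gt1.
(* [S] bounds the mass of the kernel, [C1] comes from the pointwise estimate, [C2] from the
   comparison with dyadic blocks, and 24 from the bumps. *)
pose S := 2 / (1 - ratio p).
pose C1 := (64 * M) `^ p * S `^ (p - 1).
pose C2 := 1 + (2 * (1 + M)) `^ p * 2 `^ (p + 1).
pose K := C1 * (24 * (S * C2)).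
have S0 : 0 < S by rewrite divr_gt0// subr_gt0.
have C10 : 0 < C1 by apply: mulr_gt0; apply: powR_gt0 => //; rewrite mulr_gt0.
have C20 : 0 < C2 by rewrite addr_gt0// mulr_gt0 ?powR_gt0// mulr_gt0// addr_gt0.
have K0 : 0 < K by apply: mulr_gt0 => //; apply: mulr_gt0 => //; exact: mulr_gt0.
exists ((2 * K) `^ p^-1); split; first by rewrite powR_gt0// mulr_gt0.
move=> n n1; have nR : 0 < n%:R :> R by rewrite ltr0n.
have h0 : 0 < n%:R^-1 :> R by rewrite invr_gt0.
set X := \sum_(1 <= k < n) _; set Y := (\sum_(n <= k <oo) _)%E.
have X0 : 0 <= X by apply: sumr_ge0 => k _; rewrite mulr_ge0 ?powR_ge0.
have Y0 : (0 <= Y)%E by apply: nneseries_ge0 => k _ _; rewrite lee_fin mulr_ge0 ?powR_ge0.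
apply: ge_ereal_sup => _ [t /= t0n <-].
rewrite in_itv/= in t0n.
have nX : (n%:R `^ (- p) * X) `^ p^-1 = n%:R^-1 * X `^ p^-1.
  rewrite powRM ?powR_ge0// -powRrM mulNr mulfV ?gt_eqF//.
  by rewrite powR_inv1.
have := poweR_add_le p K (n%:R `^ (- p) * X) Y p_gt0 K0
  (mulr_ge0 (powR_ge0 _ _) X0) Y0.
rewrite nX mulrA; apply: le_trans.
have I0 : (0 <= \int[@lebesgue_measure R]_(x in `[0%R, (2 * pi)%R])
     (`|cos_series lam (x + t) - cos_series lam x| `^ p)%:E)%E.
  by apply: integral_ge0 => x _; rewrite lee_fin powR_ge0.
apply: gt0_ler_poweR; rewrite ?invr_ge0 ?(ltW p_gt0)// ?in_itv/= ?andbT ?leey ?I0//.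
  by rewrite mule_ge0 ?adde_ge0 ?lee_fin ?(ltW K0) ?mulr_ge0 ?powR_ge0.
(* With h = 1/n the chain runs from the integral to the E_i, then to the g_j^p, then to the weighted
   series, whose split form is the sum on the right. *)
apply: le_trans (Lp_diff_integral_le p lam M n%:R^-1 p_gt1 lam_ge0 M_gt0 lam_gbv
  lam_cvg0 h0 _ t t0n) _; first by rewrite invf_le1 ?ler1n.
rewrite -weighted_series_split// -/S -/C1 /K (EFinM C1) -muleA.
apply: lee_wpmul2l; first by rewrite lee_fin ltW.
rewrite (EFinM 24) -muleA lee_wpmul2l ?lee_fin//.
apply: le_trans (sum_dyadic_conv_le p lam n%:R^-1 p_gt1) _.
rewrite -/S (EFinM S) -muleA lee_wpmul2l ?lee_fin ?(ltW S0)//.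
exact: sum_dyadic_weight_eseries_le.
Qed.
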